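(* Let $K$ be a field with a non-trivial valuation $v$, and let $A(x)=\sum_{i=0}^n a_ix^i\in K[x]$ be a polynomial of degree $n$ (so $a_n\neq 0$). Assume that the characteristic of the residue field of $v$ does not divide $n$. Suppose that for some $g=\begin{pmatrix} s & t\\ u & w\end{pmatrix}\in GL(2,K)$ with $stuw=0$, the polynomial $A(x)g$ is an Eisenstein–Dumas polynomial at $v$. Then at least one of the following holds: (a) the polynomial $$U(A(x))=A(x)\begin{pmatrix} 1 & -\frac{a_{n-1}}{na_n}\\ 0 & 1\end{pmatrix}=A\Big(x-\frac{a_{n-1}}{na_n}\Big)$$ is an Eisenstein–Dumas polynomial at $v$; or (b) $a_0\neq 0$ and the polynomial $$L(A(x))=A(x)\begin{pmatrix} 1 & 0\\ -\frac{a_{1}}{na_0} & 1\end{pmatrix}=\Big(1-\frac{a_1}{na_0}x\Big)^nA\Big(\frac{x}{1-\frac{a_1}{na_0}x}\Big)$$ is an Eisenstein–Dumas polynomial at $v$.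
   Context: $\Gamma$ is a linearly ordered abelian group, extended by a symbol $\infty$ with $g<\infty$ and $g+\infty=\infty+g=\infty+\infty=\infty$ for all $g\in\Gamma$. A (Krull) valuation on a field $K$ is a map $v:K\to\Gamma\cup\{\infty\}$ with $v(a)=\infty$ iff $a=0$, $v(ab)=v(a)+v(b)$, $v(a+b)\ge\min\{v(a),v(b)\}$; it is assumed non-trivial, and $K$ is not assumed henselian. The residue field of $v$ is $R_v/M_v$ where $R_v=\{a: v(a)\ge 0\}$, $M_v=\{a:v(a)>0\}$. For a polynomial written as $B(x)=\sum_{i=0}^n b_ix^i$ with a specified $n$, $B$ is an Eisenstein–Dumas polynomial at $v$ if (D0) $b_0b_n\neq0$; (D1) $v(b_0)-v(b_n)\notin k\Gamma=\{kg:g\in\Gamma\}$ for every integer $k>1$ dividing $n$; (D2) $nv(b_i)\ge (n-i)v(b_0)+iv(b_n)$ for $0\le i\le n$. Action of $GL(2,K)$: for $A(x)\in K[x]$ of degree $n$ and $g=\begin{pmatrix} a&b\\ c&d\end{pmatrix}\in GL(2,K)$, $A(x)g=(cx+d)^nA\big(\frac{ax+b}{cx+d}\big)$, regarded as a polynomial of (formal) degree $n$, i.e. written as $\sum_{i=0}^n b_ix^i$ with $b_n$ possibly zero; this is a right action, and every element of an orbit is regarded as having degree $n$. Note $n\cdot 1_K\neq 0$ under the residue-characteristic hypothesis, so $U(A(x))$ is defined.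
   Formalization: The degree n is assumed to be at least 2: for n = 1 the statement is false (A = x+1 with g the identity is Eisenstein–Dumas, but U(A) = x and L(A) = 1 both violate (D0)), and n = 0 is already excluded by the characteristic assumption. *)

(* Defs.v *)
From HB Require Import structures.
From mathcomp Require Import all_boot all_order all_algebra.
From mathcomp Require Import ring_quotient fraction.

Set Implicit Arguments.
Unset Strict Implicit.
Unset Printing Implicit Defensive.

Import Order.TTheory GRing.Theory.
Local Open Scope ring_scope.
Local Open Scope quotient_scope.

(* Totality is a field of the mixin (rather than [Order.Total] a parent) to
   stay clear of the joins of the library's order and number hierarchies. *)
HB.mixin Record isOrderedGroup G of Num.POrderedZmodule G := {
  og_le_total : total (<=%R : rel G);
  og_leD2r : forall z x y : G, x <= y -> x + z <= y + z
}.

#[short(type="orderedGroupType")]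
HB.structure Definition OrderedGroup :=
  {G of isOrderedGroup G & Num.POrderedZmodule G}.

Section OrderedGroupTheory.
Variable G : orderedGroupType.
Implicit Types x y z t : G.

Lemma og_leD x y z t : x <= y -> z <= t -> x + z <= y + t.
Proof.
move=> xy zt; apply: (@le_trans _ _ (y + z)); first exact: og_leD2r.
by rewrite ![y + _]addrC; apply: og_leD2r.
Qed.

Lemma og_mulr2_eq0 x : x + x = 0 -> x = 0.
Proof.
move=> xx; apply/eqP; rewrite eq_le; case/orP: (og_le_total x 0) => x0.
- by rewrite x0; have := og_leD2r x _ _ x0; rewrite xx add0r.
- by rewrite x0 andbT; have := og_leD2r x _ _ x0; rewrite xx add0r.
Qed.

End OrderedGroupTheory.

(* [None] is the symbol infinity, [Some g] the group element [g]; below,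
   [extended G] gets the addition and the order that make infinity an
   absorbing greatest element. *)

Definition extended (G : Type) : Type := option G.

HB.instance Definition _ (G : eqType) := Equality.on (extended G).
HB.instance Definition _ (G : choiceType) := Choice.on (extended G).

Section Extended.
Variable G : orderedGroupType.
Local Notation E := (extended G).

Definition ext_add (x y : E) : E :=
  match x, y with
  | Some g, Some h => Some (g + h)
  | _, _ => None
  end.

Definition ext_le (x y : E) : bool :=
  match x, y with
  | _, None => true
  | None, Some _ => false
  | Some g, Some h => g <= h
  end.

Lemma ext_addA : associative ext_add.
Proof. by move=> [x|] [y|] [z|] //=; rewrite addrA. Qed.

Lemma ext_addC : commutative ext_add.
Proof. by move=> [x|] [y|] //=; rewrite addrC. Qed.

Lemma ext_add0 : left_id (Some 0 : E) ext_add.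
Proof. by move=> [x|] //=; rewrite add0r. Qed.

HB.instance Definition _ := GRing.isNmodule.Build E ext_addA ext_addC ext_add0.

Lemma ext_le_anti : antisymmetric ext_le.
Proof. by move=> [x|] [y|] //= /le_anti ->. Qed.

Lemma ext_le_trans : transitive ext_le.
Proof. by move=> [y|] [x|] [z|] //=; apply: le_trans. Qed.

Lemma ext_le_total : total ext_le.
Proof. by move=> [x|] [y|] //=; apply: og_le_total. Qed.

HB.instance Definition _ := @Order.isOrder.Build ring_display E
  ext_le _ _ _ (fun _ _ => erefl) (fun _ _ => erefl) (fun _ _ => erefl)
  ext_le_anti ext_le_trans ext_le_total.

Lemma ext_leD (x y z t : E) : x <= y -> z <= t -> x + z <= y + t.
Proof. by case: x y z t => [x|] [y|] [z|] [t|] //=; apply: og_leD. Qed.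

(* Meaningful for finite elements only: [finval None = 0] is a default. *)
Definition finval (x : E) : G := odflt 0 x.

End Extended.

Record valuation (K : fieldType) (G : orderedGroupType) := Valuation {
  val_fun :> K -> extended G;
  val_infty : forall a, val_fun a = None <-> a = 0;
  valM : forall a b, val_fun (a * b) = val_fun a + val_fun b;
  valD : forall a b, Num.min (val_fun a) (val_fun b) <= val_fun (a + b)
}.

Definition nontrivial_valuation (K : fieldType) (G : orderedGroupType)
    (v : valuation K G) : Prop :=
  exists2 a : K, a != 0 & v a != 0.

Section ResidueField.
Variables (K : fieldType) (G : orderedGroupType) (v : valuation K G).

Lemma val0 : v 0 = None.
Proof. exact/val_infty. Qed.

Lemma val1 : v 1 = 0.
Proof.
have := valM v 1 1; rewrite mulr1; case E1: (v 1) => [g|].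
  case=> gg; congr Some; apply: (addrI g); by rewrite addr0 -gg.
by move/val_infty: E1 => /eqP; rewrite oner_eq0.
Qed.

Lemma valN1 : v (-1) = 0.
Proof.
have := valM v (-1) (-1); rewrite mulrNN mulr1 val1.
by case: (v (-1)) => [g|] // [/esym/og_mulr2_eq0 ->].
Qed.

Lemma valN a : v (- a) = v a.
Proof. by rewrite -mulN1r valM valN1 add0r. Qed.

Lemma valD_ge (c : extended G) a b : c <= v a -> c <= v b -> c <= v (a + b).
Proof. by move=> ca cb; apply: le_trans (valD v a b); rewrite le_min ca. Qed.

Lemma valD_gt (c : extended G) a b : c < v a -> c < v b -> c < v (a + b).
Proof. by move=> ca cb; apply: lt_le_trans (valD v a b); rewrite lt_min ca. Qed.

Definition in_val_ring : {pred K} := [pred a | (0 : extended G) <= v a].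

Lemma in_val_ring_subring : subring_closed in_val_ring.
Proof.
split=> [|a b|a b]; rewrite !inE.
- by rewrite val1.
- by move=> a0 b0; rewrite valD_ge // valN.
- by move=> a0 b0; rewrite valM -[0]addr0 ext_leD.
Qed.

HB.instance Definition _ :=
  GRing.isSubringClosed.Build K in_val_ring in_val_ring_subring.

Record val_ring := ValRing {
  val_ring_val : K;
  val_ring_valP : val_ring_val \in in_val_ring
}.

HB.instance Definition _ := [isSub for val_ring_val].
HB.instance Definition _ := [Choice of val_ring by <:].
HB.instance Definition _ := [SubChoice_isSubComNzRing of val_ring by <:].

Definition val_maxideal : {pred val_ring} :=
  [pred a : val_ring | (0 : extended G) < v (val a)].

Lemma val_maxideal_idealr : idealr_closed val_maxideal.
Proof.
split=> [||a x y]; rewrite !inE.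
- by rewrite rmorph0 val0.
- by rewrite rmorph1 val1 ltxx.
move=> x0 y0; rewrite rmorphD rmorphM; apply: valD_gt => //.
rewrite valM; apply: lt_le_trans x0 _; rewrite -[leLHS]add0r.
by rewrite ext_leD //; have := val_ring_valP a; rewrite inE.
Qed.

HB.instance Definition _ :=
  isIdealr.Build val_ring val_maxideal val_maxideal_idealr.

Definition residue_field := {ideal_quot val_maxideal}.

HB.instance Definition _ := GRing.ComNzRing.on residue_field.

Definition residue_inv (x : residue_field) : residue_field :=
  if x == 0 then 0 else \pi_residue_field (insubd (0 : val_ring) (val (repr x))^-1).

Lemma residue_mulVf (x : residue_field) : x != 0 -> residue_inv x * x = 1.
Proof.
rewrite /residue_inv => x0; rewrite (negPf x0); move: x0.
rewrite -{1 3}[x]reprK; set a := repr x.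
rewrite -(rmorph0 \pi_residue_field) -Quotient.idealrBE subr0 inE -leNgt => a0.
have va0 : v (val a) = 0.
  by apply: le_anti; rewrite a0; have := val_ring_valP a; rewrite inE.
have a_neq0 : val a != 0.
  by apply/eqP => a00; move: va0; rewrite a00 val0.
have aV : (val a)^-1 \in in_val_ring.
  by rewrite inE -[v _]addr0 -va0 -valM mulVf // val1.
rewrite -rmorphM -(rmorph1 \pi_residue_field); congr (\pi_residue_field _).
by apply: val_inj; rewrite rmorphM rmorph1 /= insubdK // mulVf.
Qed.

Lemma residue_inv0 : residue_inv 0 = 0.
Proof. by rewrite /residue_inv eqxx. Qed.

HB.instance Definition _ :=
  GRing.ComNzRing_isField.Build residue_field residue_mulVf residue_inv0.

End ResidueField.

(* [B] is read as [\sum_(i <= n) B`_i x^i]. As [B`_0] and [B`_n] are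
   nonzero, their values are finite and [finval] only removes the [Some]. *)
Definition EisensteinDumas (K : fieldType) (G : orderedGroupType)
    (v : valuation K G) (n : nat) (B : {poly K}) : Prop :=
  [/\ (size B <= n.+1)%N,
      B`_0 * B`_n != 0,
      forall k : nat, (1 < k)%N -> (k %| n)%N ->
        ~ exists g : G, finval (v B`_0) - finval (v B`_n) = g *+ k
    & forall i : nat, (i <= n)%N ->
        v B`_0 *+ (n - i) + v B`_n *+ i <= v B`_i *+ n].

Definition mx2 (K : fieldType) (a b c d : K) : 'M[K]_2 :=
  \matrix_(i, j) (nth [::] [:: [:: a; b]; [:: c; d]] i)`_j.

(* [(c x + d)^n A((a x + b) / (c x + d))] with the denominators cleared;
   see [gl2_actE]. *)
Definition gl2_act (K : fieldType) (n : nat) (A : {poly K}) (g : 'M[K]_2) :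
    {poly K} :=
  \sum_(i < n.+1) A`_i *: ((g 0 0 *: 'X + (g 0 1)%:P) ^+ i
                           * (g 1 0 *: 'X + (g 1 1)%:P) ^+ (n - i)).

Lemma gl2_actE (K : fieldType) (n : nat) (A : {poly K}) (g : 'M[K]_2)
    (num := g 0 0 *: 'X + (g 0 1)%:P) (den := g 1 0 *: 'X + (g 1 1)%:P) :
  (size A <= n.+1)%N -> g \in unitmx ->
  tofrac (gl2_act n A g)
    = tofrac den ^+ n
      * (map_poly (fun a : K => tofrac a%:P) A).[tofrac num / tofrac den].
Proof.
move=> szA gU.
have den0 : den != 0.
  apply: contraTneq gU => den0; rewrite unitmxE unitfE negbK.
  have c0 : g 1 0 = 0.
    by have := congr1 (coefp 1) den0;
       rewrite /= coefD coefZ coefX coefC coef0 /= mulr1 addr0.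
  have d0 : g 1 1 = 0.
    by have := congr1 (coefp 0) den0;
       rewrite /= coefD coefZ coefX coefC coef0 /= mulr0 add0r.
  rewrite (expand_det_row _ 1) big1 // => j _.
  have [->|->] : j = 0 \/ j = 1.
    by case: j => [[|[|j]] Hj] //; [left|right]; apply: val_inj.
  - by rewrite c0 mul0r.
  - by rewrite d0 mul0r.
have fden0 : tofrac den != 0 by rewrite tofrac_eq0.
rewrite (@horner_coef_wide _ n.+1); last exact: leq_trans (size_poly _ _) szA.
rewrite /gl2_act rmorph_sum mulr_sumr; apply: eq_bigr => i _ /=.
rewrite -mul_polyC !rmorphM !rmorphXn /= -/num -/den.
rewrite coef_map_id0 ?rmorph0 // expr_div_n.
rewrite [RHS]mulrCA; congr (_ * _).
have le_in : (i <= n)%N by rewrite -ltnS.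
have -> : tofrac den ^+ n = tofrac den ^+ (n - i) * tofrac den ^+ i.
  by rewrite -exprD subnK.
rewrite mulrC -mulrA; congr (_ * _).
rewrite mulrCA divff; first by rewrite mulr1.
exact: expf_neq0 fden0.
Qed.

Definition U_poly (K : fieldType) (n : nat) (A : {poly K}) : {poly K} :=
  gl2_act n A (mx2 1 (- (A`_n.-1 / (n%:R * A`_n))) 0 1).

Definition L_poly (K : fieldType) (n : nat) (A : {poly K}) : {poly K} :=
  gl2_act n A (mx2 1 0 (- (A`_1 / (n%:R * A`_0))) 1).

(* Main.v *)
(* Put [B = A g].  If [u = 0], then [B] is [A] composed with an affine map, and
   [U(A)] is, up to diagonal scaling, the translate [B(x + y)] that kills the
   coefficient of [x^(n-1)], so [y = - b_(n-1) / (n b_n)].  As [v n = 0], (D2)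
   at [i = n-1] gives [n v(y) >= v b_0 - v b_n], and (D1) with [k = n] makes
   this strict; such a translation preserves the Eisenstein-Dumas conditions,
   and so does a diagonal scaling.  Reversal of coefficients preserves these
   conditions too; applied to [B] it swaps the columns of [g], which reduces
   [w = 0] to [u = 0] and [s = 0] to [t = 0], and applied to [A] it swaps the
   rows, which exchanges [U] and [L] and reduces [t = 0] to [u = 0]. *)

Require Import Defs.
From HB Require Import structures.
From mathcomp Require Import all_boot all_order all_algebra.
From mathcomp Require Import ring_quotient ring.

Import GRing.Theory.
Local Open Scope ring_scope.

Import Order.TTheory.

Set Implicit Arguments.
Unset Strict Implicit.

(** * Order and multiples in the extended group *)

Section ExtendedOrder.
Variable G : orderedGroupType.
Local Notation E := (extended G).
Implicit Types x y z : E.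

Lemma ext_leD2l x y (g : G) : ((Some g : E) + x <= (Some g : E) + y) = (x <= y).
Proof.
apply/idP/idP => [|xy]; last exact: ext_leD.
move=> /(ext_leD (lexx (Some (- g) : E))); rewrite !addrA.
have -> : (Some (- g) : E) + (Some g : E) = 0 by congr Some; rewrite addNr.
by rewrite !add0r.
Qed.

Lemma ext_ltD2l x y (g : G) : ((Some g : E) + x < (Some g : E) + y) = (x < y).
Proof. by rewrite !ltNge ext_leD2l. Qed.

Lemma ext_le_None x : x <= (None : E).
Proof. by case: x. Qed.

Lemma ext_lt_finite x y : x < y -> exists g, x = Some g.
Proof. by case: x => [g|]; [exists g | rewrite ltNge ext_le_None]. Qed.

Lemma ext_le_muln n x y : x <= y -> x *+ n <= y *+ n.
Proof.
by move=> xy; elim: n => [|n IHn]; rewrite ?mulr0n // !mulrS ext_leD.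
Qed.

(** A strict inequality forces its smaller side to be finite, so adding that side keeps it
    strict. *)
Lemma ext_lt_muln n x y : x < y -> x *+ n.+1 < y *+ n.+1.
Proof.
move=> xy; have [g xg] := ext_lt_finite xy; elim: n => [|n IHn] //.
rewrite !(mulrS _ n.+1); apply: (@lt_le_trans _ _ (x + y *+ n.+1)).
  by rewrite xg ext_ltD2l -xg.
by rewrite ext_leD // ltW.
Qed.

Lemma ext_lt_of_muln n x y : x *+ n < y *+ n -> x < y.
Proof. by rewrite !ltNge; apply: contraNN; apply: ext_le_muln. Qed.

Lemma ext_SomeMn (g : G) n : (Some g : E) *+ n = Some (g *+ n).
Proof. by elim: n => // n IHn; rewrite !mulrS IHn. Qed.

Lemma ext_NoneMn n : (None : E) *+ n.+1 = None.
Proof. by rewrite mulrS. Qed.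

End ExtendedOrder.

(** * Values of powers, sums and integers *)

Section Valuation.
Variables (K : fieldType) (G : orderedGroupType) (v : valuation K G).
Local Open Scope quotient_scope.
Local Notation E := (extended G).

Lemma val_finite {a : K} : a != 0 -> exists g, v a = Some g.
Proof.
by case va: (v a) => [g|]; [exists g | move/val_infty: va => ->; rewrite eqxx].
Qed.

Lemma valX (a : K) n : v (a ^+ n) = v a *+ n.
Proof.
elim: n => [|n IHn]; first by rewrite expr0 mulr0n Defs.val1.
by rewrite exprS Defs.valM IHn mulrS.
Qed.

Lemma val_natr_ge0 n : (0 : E) <= v n%:R.
Proof.
elim: n => [|n IHn]; first by rewrite val0.
by rewrite mulrS; apply: valD_ge; rewrite ?Defs.val1.
Qed.

Lemma val_mulrn_ge (a : K) n : v a <= v (a *+ n).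
Proof.
by rewrite -mulr_natr Defs.valM -[leLHS]addr0 ext_leD // val_natr_ge0.
Qed.

(** If [v (a + b)] exceeded [v a], then [a = (a + b) - b] would have a value larger than its own. *)
Lemma valD_lt (a b : K) : v a < v b -> v (a + b) = v a.
Proof.
move=> ab; apply/eqP; rewrite eq_le (@valD_ge _ _ _ (v a)) ?(ltW ab) // andbT.
rewrite leNgt; apply/negP => h.
have : v a < v (a + b - b) by apply: valD_gt => //; rewrite valN.
by rewrite addrK ltxx.
Qed.

(** The bound stays on [n]-fold multiples because [c] need not be divisible by [n] in [G]. *)
Lemma valXD_ge c (a b : K) n :
  c <= v a *+ n -> c <= v b *+ n -> c <= v (a + b) *+ n.
Proof.
move=> ca cb; have := valD v a b; rewrite /Num.min; case: ifP => _ h.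
- exact: le_trans ca (ext_le_muln _ h).
- exact: le_trans cb (ext_le_muln _ h).
Qed.

(** If [v n] were positive, [n] would vanish in the residue field, whose characteristic would then
    be a prime dividing [n]. *)
Lemma val_natr_eq0 n :
    (0 < n)%N ->
    (forall p : nat, p \in [pchar (residue_field v)] -> ~~ (p %| n)%N) ->
  v n%:R = 0.
Proof.
move=> n_gt0 hchar; apply/eqP; rewrite eq_le val_natr_ge0 andbT leNgt.
apply/negP => vn.
have n0 : n%:R == 0 :> residue_field v.
  rewrite -(rmorph_nat \pi_(residue_field v)) -(rmorph0 \pi_(residue_field v)).
  by rewrite -Quotient.idealrBE subr0 inE rmorph_nat.
have [p pchar] := natf0_pchar n_gt0 n0.
by have := hchar p pchar; rewrite (dvdn_pcharf pchar) n0.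
Qed.

End Valuation.

(** * Coefficients of the matrix action, and their reversal *)

Section Coefficients.
Variable K : fieldType.
Implicit Types (A B p q : {poly K}).

Lemma mx2E (a b c d : K) (g := mx2 a b c d) :
  ((g 0 0 = a) * (g 0 1 = b) * (g 1 0 = c) * (g 1 1 = d))%type.
Proof. by rewrite /g /mx2 !mxE. Qed.

Lemma mx2_unit (a b c d : K) : (mx2 a b c d \in unitmx) = (a * d - b * c != 0).
Proof.
rewrite unitmxE unitfE (expand_det_row _ 0) !big_ord_recl big_ord0 addr0.
rewrite /cofactor !det_mx11 /mx2 !mxE /= expr0 expr1 mul1r mulN1r mulrN.
by [].
Qed.

Lemma coef_linX (a b : K) i j :
  ((a *: 'X + b%:P) ^+ i)`_j = a ^+ j * b ^+ (i - j) *+ 'C(i, j).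
Proof.
rewrite addrC exprDn coef_sum.
under eq_bigr => k _.
  rewrite coefMn exprZn -scalerAr coefZ -rmorphXn /= coefCM coefXn.
over.
case: (leqP j i) => ji.
  rewrite (bigD1 (Ordinal (ji : (j < i.+1)%N))) //= eqxx mulr1.
  rewrite big1 ?addr0 // => k kj; rewrite eq_sym.
  by rewrite -val_eqE /= in kj; rewrite (negPf kj) !mulr0 mul0rn.
rewrite bin_small // mulr0n big1 // => k _.
by rewrite (gtn_eqF (leq_trans (ltn_ord k) ji)) !mulr0 mul0rn.
Qed.

Lemma coef_gl2_act_upper n A (s t w : K) j :
  (gl2_act n A (mx2 s t 0 w))`_j
    = \sum_(i < n.+1)
        A`_i * ((s ^+ j * t ^+ (i - j) *+ 'C(i, j)) * w ^+ (n - i)).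
Proof.
rewrite /gl2_act coef_sum; apply: eq_bigr => i _.
by rewrite !mx2E scale0r add0r -rmorphXn /= coefZ coefMC coef_linX.
Qed.

Lemma size_gl2_act_upper n A (s t w : K) :
  (size (gl2_act n A (mx2 s t 0 w)) <= n.+1)%N.
Proof.
apply/leq_sizeP => j nj; rewrite coef_gl2_act_upper big1 // => i _.
by rewrite bin_small ?mulr0n ?mul0r ?mulr0 // (leq_trans (ltn_ord i)).
Qed.

(** Translation by [y] is the action of [mx2 1 y 0 1], which multiplies [mx2 s t 0 w] on the
    right. *)
Lemma comp_gl2_act_upper n A (s t w y : K) :
  gl2_act n A (mx2 s t 0 w) \Po ('X + y%:P)
    = gl2_act n A (mx2 s (s * y + t) 0 w).
Proof.
rewrite /gl2_act rmorph_sum; apply: eq_bigr => i _ /=.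
rewrite !mx2E !scale0r !add0r comp_polyZ rmorphM !rmorphXn /=.
rewrite rmorphD /= comp_polyZ comp_polyX !comp_polyC scalerDr.
by rewrite polyCD polyCM mul_polyC addrA.
Qed.

(** The matrix on the left is [mx2 1 c 0 1] times the diagonal matrix [mx2 s 0 0 w], which only
    rescales coefficients. *)
Lemma coef_gl2_act_scale n A (s c w : K) j : (j <= n)%N ->
  (gl2_act n A (mx2 s (w * c) 0 w))`_j
    = s ^+ j * w ^+ (n - j) * (gl2_act n A (mx2 1 c 0 1))`_j.
Proof.
move=> jn; rewrite !coef_gl2_act_upper mulr_sumr; apply: eq_bigr => i _.
have [ij|ji] := ltnP i j; first by rewrite bin_small // !mulr0n !mul0r !mulr0.
have -> : (n - j = (i - j) + (n - i))%N.
  by rewrite addnC addnBA // subnK // -ltnS.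
rewrite exprMn exprD !expr1n !mulrnAl !mulrnAr; congr (_ *+ _); ring.
Qed.

Lemma coef_comp_XaddC n B (y : K) j : (size B <= n.+1)%N ->
  (B \Po ('X + y%:P))`_j
    = \sum_(i < n.+1) B`_i * (y ^+ (i - j) *+ 'C(i, j)).
Proof.
move=> szB; rewrite /comp_poly (@horner_coef_wide _ n.+1) ?coef_sum; last first.
  exact: leq_trans (size_poly _ _) szB.
apply: eq_bigr => i _; rewrite coef_map /= coefCM -['X]scale1r coef_linX.
by rewrite expr1n mul1r.
Qed.

(** The action of [mx2 0 1 1 0] in formal degree [n]; it is [x^n A(1/x)] when [size A <= n.+1]. *)
Definition poly_rev n A : {poly K} := \poly_(i < n.+1) A`_(n - i).

Lemma size_poly_rev n A : (size (poly_rev n A) <= n.+1)%N.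
Proof. exact: size_poly. Qed.

Lemma coef_poly_rev n A i : (i <= n)%N -> (poly_rev n A)`_i = A`_(n - i).
Proof. by move=> ni; rewrite coef_poly ltnS ni. Qed.

(** Reindexing the sum by [n - i] exchanges the two linear forms, that is, the rows. *)
Lemma gl2_act_poly_rev n A (s t u w : K) :
  gl2_act n (poly_rev n A) (mx2 s t u w) = gl2_act n A (mx2 u w s t).
Proof.
rewrite /gl2_act [RHS](reindex_inj rev_ord_inj); apply: eq_bigr => i _ /=.
have iN : (i <= n)%N by rewrite -ltnS.
by rewrite coef_poly_rev // !mx2E subSS subKn // [X in _ *: X]mulrC.
Qed.

(** Reversal is multiplicative when formal degrees add up; linear factors suffice, as the action is
    built from them. *)
Lemma poly_rev_linM n p (a b : K) : (size p <= n.+1)%N ->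
  poly_rev n.+1 ((a *: 'X + b%:P) * p) = (b *: 'X + a%:P) * poly_rev n p.
Proof.
move=> szp; apply/polyP => i.
rewrite !mulrDl -!scalerAl !mul_polyC coefD !coefZ coefXM !coef_poly.
rewrite coefD !coefZ coefXM.
have [i_lt|] := ltnP i n.+2; last first.
  case: i => // i /ltnSE ni; rewrite /= !ltnS [(i <= n)%N]leqNgt ni.
  by rewrite [(i < n)%N]ltnNge ltnW //= !mulr0 addr0.
case: i i_lt => [_|i].
  by rewrite subn0 /= (nth_default _ szp) subn0; ring.
rewrite subSS /= !ltnS => iN; rewrite iN.
move: iN; rewrite leq_eqVlt => /predU1P[->|iN].
  by rewrite subnn ltnn /=; ring.
by rewrite iN subnS addrC; move: iN; rewrite -subn_gt0 => /gtn_eqF ->.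
Qed.

Lemma size_linM n p (a b : K) : (size p <= n.+1)%N ->
  (size ((a *: 'X + b%:P) * p)%R <= n.+2)%N.
Proof.
move=> szp; apply/leq_sizeP => j nj.
rewrite mulrDl -scalerAl mul_polyC coefD !coefZ coefXM.
case: j nj => // j nj.
by rewrite !(leq_sizeP _ _ szp) ?mulr0 ?addr0 // ltnW.
Qed.

(** The size bound travels through the induction because [poly_rev_linM] requires it. *)
Lemma poly_rev_linX n i p (a b : K) : (size p <= n.+1)%N ->
  (size ((a *: 'X + b%:P) ^+ i * p)%R <= (i + n).+1)%N
  /\ poly_rev (i + n) ((a *: 'X + b%:P) ^+ i * p)
       = (b *: 'X + a%:P) ^+ i * poly_rev n p.
Proof.
move=> szp; elim: i => [|i [szi IHi]]; first by rewrite !expr0 !mul1r.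
rewrite !exprS -!mulrA; split; first exact: size_linM.
by rewrite addSn poly_rev_linM // IHi.
Qed.

(** Each term is a scalar times a product of [n] linear forms, and reversal exchanges the two
    coefficients of each form. *)
Lemma poly_rev_gl2_act n A (s t u w : K) :
  poly_rev n (gl2_act n A (mx2 s t u w)) = gl2_act n A (mx2 t s w u).
Proof.
have rev_term i : (i <= n)%N ->
    poly_rev n ((s *: 'X + t%:P) ^+ i * (u *: 'X + w%:P) ^+ (n - i))
      = (t *: 'X + s%:P) ^+ i * (w *: 'X + u%:P) ^+ (n - i).
  move=> iN; have sz1 : (size (1 : {poly K})%R <= 1)%N by rewrite size_poly1.
  have rev1 : poly_rev 0 1 = 1.
    by apply/polyP => k; rewrite coef_poly !coef1; case: k.
  have [] := poly_rev_linX (n - i) u w sz1.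
  rewrite addn0 rev1 !mulr1 => szq revq.
  by have [_] := poly_rev_linX i s t szq; rewrite subnKC // revq.
apply/polyP => j; rewrite coef_poly.
case: ifP => jn.
  rewrite /gl2_act !coef_sum; apply: eq_bigr => i _.
  by rewrite !mx2E !coefZ -rev_term ?leq_ord // coef_poly jn.
rewrite /gl2_act coef_sum big1 // => i _.
by rewrite !mx2E coefZ -rev_term ?leq_ord // coef_poly jn mulr0.
Qed.

Lemma size_gl2_act n A (s t u w : K) :
  (size (gl2_act n A (mx2 s t u w)) <= n.+1)%N.
(* The polynomial is itself a reversal, hence bounded by construction. *)
Proof. by rewrite -poly_rev_gl2_act size_poly_rev. Qed.

End Coefficients.

(** * Stability of the Eisenstein-Dumas conditions, and the two triangular cases *)

Section EisensteinDumasTheory.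
Variables (K : fieldType) (G : orderedGroupType) (v : valuation K G).
Local Notation E := (extended G).
Implicit Types (A B C : {poly K}).

Lemma ED_finite n B : EisensteinDumas v n B ->
  exists p q, v B`_0 = Some p /\ v B`_n = Some q.
Proof.
case=> _; rewrite mulf_eq0 negb_or => /andP[b0 bn] _ _.
by have [[p ?] [q ?]] := (val_finite v b0, val_finite v bn); exists p, q.
Qed.

(** The difference in (D1) changes by a multiple of [n], hence of [k]; both sides of (D2) gain
    [n v(e) + n i v(a)]. *)
Lemma ED_scale n B C (e a : K) : e != 0 -> a != 0 -> (size C <= n.+1)%N ->
    (forall i, (i <= n)%N -> C`_i = e * a ^+ i * B`_i) ->
  EisensteinDumas v n B -> EisensteinDumas v n C.
Proof.
move=> e0 a0 szC hC hB; have [p [q [vp vq]]] := ED_finite hB.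
case: hB => szB; rewrite mulf_eq0 negb_or => /andP[b0 bn] D1 D2.
have [[ve hve] [va hva]] := (val_finite v e0, val_finite v a0).
have vC0 : v C`_0 = Some (ve + p) by rewrite hC // expr0 mulr1 Defs.valM hve vp.
have vCn : v C`_n = Some (ve + va *+ n + q).
  by rewrite hC // !Defs.valM valX hve hva vq ext_SomeMn.
split=> //.
- by rewrite !hC // !mulf_neq0 ?expf_neq0.
- move=> k k1 kn [g]; rewrite vC0 vCn /= => hg; apply: (D1 k k1 kn).
  exists (g + va *+ (n %/ k)); rewrite vp vq /= mulrnDl -hg -mulrnA divnK //.
  rewrite -[ve + _ + q]addrA [ve + p]addrC addrKA.
  by rewrite [_ + q]addrC opprD addrA subrK.
move=> i iN; have {}D2 := D2 i iN.
rewrite !hC // !Defs.valM !valX mulr0n addr0.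
set x := v e; set y := v a; set b := v B`_i; set b0' := v _; set bn' := v _.
have -> : (x + b0') *+ (n - i) + (x + y *+ n + bn') *+ i
        = (x *+ n + y *+ n *+ i) + (b0' *+ (n - i) + bn' *+ i).
  rewrite -{3}(subnK iN) !mulrnDl mulrnDr.
  rewrite -!addrA; congr (_ + _); rewrite addrCA; congr (_ + _).
  by rewrite addrCA.
rewrite !mulrnDl -!mulrnA [(i * n)%N]mulnC.
exact: ext_leD.
Qed.

Lemma ED_rev n B : (size B <= n.+1)%N ->
  EisensteinDumas v n (poly_rev n B) -> EisensteinDumas v n B.
Proof.
move=> szB [_]; rewrite !coef_poly_rev // subn0 subnn => D0 D1 D2.
split=> //.
- by rewrite mulrC.
- move=> k k1 kn [g hg]; apply: (D1 k k1 kn); exists (- g).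
  by rewrite mulNrn -hg opprB.
move=> i iN; have := D2 (n - i)%N (leq_subr _ _).
by rewrite coef_poly_rev ?leq_subr // subKn // addrC.
Qed.

(* The points [(i, v b_i)] lie above the line joining [(0, v b_0)] to
   [(n, v b_n)], and [v y] exceeds minus its slope: every term of the Taylor
   expansion at [y] stays above that line. *)
Lemma ED_translate n B (y : K) :
    (0 < n)%N -> v B`_0 < v y *+ n + v B`_n ->
  EisensteinDumas v n B -> EisensteinDumas v n (B \Po ('X + y%:P)).
Proof.
move=> n0 hy hB; have [p [q [vp vq]]] := ED_finite hB.
case: hB => szB; rewrite mulf_eq0 negb_or => /andP[b0 bn] D1 D2.
set C := B \Po _.
have coefC j : C`_j = \sum_(i < n.+1) B`_i * (y ^+ (i - j) *+ 'C(i, j)).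
  exact: coef_comp_XaddC.
have Cn : C`_n = B`_n.
  rewrite coefC big_ord_recr /= subnn binn expr0 mulr1n mulr1.
  rewrite big1 ?add0r // => i _.
  by rewrite bin_small // mulr0n mulr0.
have termE i j : (i <= n)%N -> (j <= i)%N ->
    v B`_0 *+ (n - i) + v B`_n *+ i + (v y *+ n) *+ (i - j)
      <= v (B`_i * (y ^+ (i - j) *+ 'C(i, j))) *+ n.
  move=> iN ji; rewrite Defs.valM mulrnDl; apply: ext_leD; first exact: D2.
  by rewrite mulrnAC -valX ext_le_muln // val_mulrn_ge.
(* Regrouped this way, the bound differs from the line at [j] only in having
   [v y *+ n + v B]_n[where]split0[has]v B[_0], so [hy] compares them. *)
have rearr i j : (i <= n)%N -> (j <= i)%N ->
    v B`_0 *+ (n - i) + (v y *+ n + v B`_n) *+ (i - j) + v B`_n *+ j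
    = v B`_0 *+ (n - i) + v B`_n *+ i + (v y *+ n) *+ (i - j).
  move=> iN ji; rewrite mulrnDl -!addrA -mulrnDr subnK //.
  by rewrite [(v y *+ n) *+ _ + _]addrC.
have split0 i j : (i <= n)%N -> (j <= i)%N ->
    v B`_0 *+ (n - j) = v B`_0 *+ (n - i) + v B`_0 *+ (i - j).
  by move=> iN ji; rewrite -mulrnDr addnBA // subnK.
have vC0 : v C`_0 = v B`_0.
  rewrite coefC big_ord_recl /= subnn bin0 expr0 mulr1n mulr1.
  apply: valD_lt; elim/big_rec: _ => [|i x _ hx].
    by rewrite val0 vp lt_neqAle ext_le_None.
  apply: valD_gt => //; apply: (@ext_lt_of_muln _ n).
  have iN : (bump 0 i <= n)%N by [].
  apply: lt_le_trans (termE _ 0%N iN isT).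
  rewrite -rearr // mulr0n addr0 -{1}[n]subn0 (split0 _ 0%N iN) //.
  rewrite {1 3}vp ext_SomeMn ext_ltD2l subn0 /bump /=.
  exact: ext_lt_muln.
split=> //.
- apply: leq_trans (size_comp_poly_leq _ _) _.
  rewrite -['X]scale1r addrC; rewrite scale1r addrC size_XaddC muln1.
  by case: (size B) szB.
- rewrite Cn mulf_neq0 //; apply/eqP => /(val_infty v).
  by rewrite vC0 vp.
- by move=> k k1 kn; rewrite Cn vC0; apply: D1.
move=> j jn; rewrite Cn vC0 coefC.
elim/big_rec: _ => [|i x _ hx].
  (* Positivity of [n] matters: infinity taken [0] times is [0], not infinity. *)
  by case: (n) n0 => // m _; rewrite val0 ext_NoneMn ext_le_None.
apply: valXD_ge => //; have iN : (i <= n)%N by rewrite -ltnS.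
have [ij|ji] := ltnP i j.
  rewrite bin_small // mulr0n mulr0 val0.
  by case: (n) n0 => // m _; rewrite ext_NoneMn ext_le_None.
apply: le_trans (termE _ _ iN ji).
rewrite -rearr // (split0 i) //.
by rewrite !ext_leD // ext_le_muln // ltW.
Qed.

Lemma ED_slope n B (y : K) : (1 < n)%N ->
    v y + v B`_n = v B`_n.-1 ->
  EisensteinDumas v n B -> v B`_0 < v y *+ n + v B`_n.
Proof.
case: n => // m n1 hy hB; have [p [q [vp vq]]] := ED_finite hB.
case: hB => _ _ D1 /(_ m (leqnSn m)); rewrite subSn // subnn -hy mulr1n.
have -> : (v y + v B`_m.+1) *+ m.+1
          = v B`_m.+1 *+ m + (v y *+ m.+1 + v B`_m.+1).
  by rewrite mulrnDl [v B`_m.+1 *+ m.+1]mulrSr addrCA.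
rewrite addrC {1 2}vq ext_SomeMn ext_leD2l => b0_le.
(* Equality would force [v y] to be finite and the difference in (D1) to be [n v(y)], excluded by
   [k = n]. *)
rewrite lt_neqAle b0_le andbT; apply/negP => /eqP; rewrite vp vq.
case: (v y) => [g|]; last by rewrite ext_NoneMn.
rewrite ext_SomeMn => -[hp]; apply: (D1 m.+1) => //; exists g.
by rewrite vp vq /= hp addrK.
Qed.

Lemma ED_U_poly n A (s t w : K) :
    (1 < n)%N -> v n%:R = 0 -> mx2 s t 0 w \in unitmx ->
    EisensteinDumas v n (gl2_act n A (mx2 s t 0 w)) ->
  A`_n != 0 /\ EisensteinDumas v n (U_poly n A).
Proof.
move=> n1 vn; rewrite mx2_unit mulr0 subr0 mulf_eq0 negb_or => /andP[s0 w0].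
set B := gl2_act n A _ => hB; have n_gt0 := ltnW n1.
have nK : n%:R != 0 :> K.
  by apply/eqP => n0; move: vn; rewrite n0 val0.
have Bn : B`_n = s ^+ n * A`_n.
  rewrite coef_gl2_act_upper big_ord_recr /= !subnn binn !expr0 mulr1n !mulr1.
  rewrite big1 ?add0r 1?mulrC // => i _.
  by rewrite bin_small // mulr0n mul0r mulr0.
have Bn1 : B`_n.-1 = s ^+ n.-1 * (w * A`_n.-1 + n%:R * t * A`_n).
  rewrite coef_gl2_act_upper; case: (n) n_gt0 => // m _.
  rewrite !big_ord_recr /= subSnn !subnn binn binSn big1 => [|i _].
    by rewrite !expr0 !expr1 -mulr_natr; ring.
  by rewrite bin_small // mulr0n mul0r mulr0.
have An0 : A`_n != 0.
  by case: hB => _; rewrite Bn !mulf_eq0 !negb_or => /andP[_ /andP[_]].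
split=> //; pose c := - (A`_n.-1 / (n%:R * A`_n)).
(* The solution of [s * y + t = w * c]: translating by [y] turns the matrix into
   [mx2 s (w * c) 0 w]. *)
pose y := (w * c - t) / s.
have hy : v y + v B`_n = v B`_n.-1.
  (* As [v n = 0], the left side is the value of [n y b_n], which equals [- b_(n-1)]. *)
  rewrite -[LHS]add0r -vn -!Defs.valM -[RHS]valN; congr (v _).
  rewrite Bn Bn1 /y /c -(prednK n_gt0) exprS /= prednK //.
  by field; rewrite nK s0 An0.
have := ED_translate n_gt0 (ED_slope n1 hy hB) hB.
rewrite comp_gl2_act_upper.
have -> : s * y + t = w * c by rewrite /y mulrC divfK // subrK.
(* These scalars undo the diagonal factor [s^i w^(n-i)]. *)
apply: (@ED_scale _ _ _ (w ^- n) (w / s)).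
- by rewrite invr_eq0 expf_neq0.
- by rewrite mulf_neq0 ?invr_eq0.
- exact: size_gl2_act_upper.
move=> i iN; rewrite coef_gl2_act_scale // /U_poly -/c.
have -> : w ^+ n = w ^+ (n - i) * w ^+ i by rewrite -exprD subnK.
rewrite expr_div_n; field.
by rewrite !expf_neq0.
Qed.

(** Reversing both [A] and its image makes the matrix upper triangular, and [L_poly n A] is the
    reversal of [U_poly n (poly_rev n A)]. *)
Lemma ED_L_poly n A (s u w : K) :
    (1 < n)%N -> v n%:R = 0 -> mx2 s 0 u w \in unitmx ->
    EisensteinDumas v n (gl2_act n A (mx2 s 0 u w)) ->
  A`_0 != 0 /\ EisensteinDumas v n (L_poly n A).
Proof.
move=> n1 vn; rewrite mx2_unit mul0r subr0 => sw0 hB.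
have {hB}hB : EisensteinDumas v n (gl2_act n (poly_rev n A) (mx2 w u 0 s)).
  rewrite gl2_act_poly_rev; apply: ED_rev; first exact: size_gl2_act.
  by rewrite poly_rev_gl2_act.
have := ED_U_poly n1 vn _ hB; rewrite mx2_unit mulr0 subr0 mulrC sw0.
move=> /(_ isT) []; rewrite coef_poly_rev // subnn => A0 hU; split=> //.
apply: ED_rev; first exact: size_gl2_act.
rewrite /L_poly poly_rev_gl2_act -gl2_act_poly_rev.
move: hU; rewrite /U_poly !coef_poly_rev ?leq_pred // subnn.
by rewrite -subn1 subKn // ltnW.
Qed.

End EisensteinDumasTheory.

Unset Implicit Arguments.
Set Strict Implicit.

Theorem theorem1p2 (G : orderedGroupType) (K : fieldType) (v : valuation K G)
    (hv : nontrivial_valuation v)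
    (n : nat) (hn : (1 < n)%N)
    (A : {poly K}) (hA : size A = n.+1)
    (hchar : forall p : nat, p \in [pchar (residue_field v)] -> ~~ (p %| n)%N)
    (hg : exists s t u w : K,
        [/\ mx2 s t u w \in unitmx, s * t * u * w = 0
          & EisensteinDumas v n (gl2_act n A (mx2 s t u w))]) :
  EisensteinDumas v n (U_poly n A)
  \/ (A`_0 != 0 /\ EisensteinDumas v n (L_poly n A)).
Proof.
have vn := val_natr_eq0 (ltnW hn) hchar.
have [s [t [u [w [gU stuw hB]]]]] := hg.
have swap : mx2 t s w u \in unitmx
    /\ EisensteinDumas v n (gl2_act n A (mx2 t s w u)).
  split.
    move: gU; rewrite !mx2_unit; apply: contraNneq => d0.
    by rewrite -[s * w - _]opprK opprB d0 oppr0.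
  by apply: ED_rev; [exact: size_gl2_act | rewrite poly_rev_gl2_act].
(* In order, [s], [t], [u] or [w] vanishes; the first and last cases use the matrix with swapped
   columns. *)
move/eqP: stuw; rewrite !mulf_eq0 -!orbA => /or4P[] /eqP z0;
  rewrite z0 in gU hB swap; have [gU' hB'] := swap.
- by right; exact: ED_L_poly hn vn gU' hB'.
- by right; exact: ED_L_poly hn vn gU hB.
- by left; have [] := ED_U_poly hn vn gU hB.
- by left; have [] := ED_U_poly hn vn gU' hB'.
Qed.
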